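(* Let $E$ be a finite set, $f:2^E\to\mathbb{R}$ a polymatroid function, $g(U):=f(E)-f(E\setminus U)$ for $U\subseteq E$, and let $s\in\mathbb{R}^E_{>0}$ and $m\in\mathbb{R}^E_{\ge 0}$. Let $c$ be a constant with $c\ge\max\{f(E),\|s\|_\infty\}$. Let $$\beta:=\max\{h>0: s\in hQ_g\},\qquad F_h:=\{z\in\mathbb{R}^E_{\ge 0}: s-z\in hC_{g,c}\}\quad(h>0),$$ where the maximum defining $\beta$ is assumed to exist. For every $0<h\le\beta$ let $z^*_h$ be an optimal solution of the problem $\min_{z\in F_h} m\cdot z$. Then $$m\cdot z^*_h\ \ge\ m\cdot z^*_\beta\qquad\text{for all } 0<h\le\beta.$$ In other words, the polymatroid sparsification problem of minimizing $m\cdot z$ over all $z\in\mathbb{R}^E_{\ge 0}$ such that $s-z\in hC_{g,c}$ for some $h>0$ is equivalent to (has the same minimum value as) the problem $\min_{z\in F_\beta} m\cdot z$.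
   Context: For $x\in\mathbb{R}^E$ and $A\subseteq E$ write $x(A)=\sum_{e\in A}x(e)$, $m\cdot z=\sum_{e\in E} m(e)z(e)$, and $\|s\|_\infty=\max_{e}|s(e)|$. A polymatroid function is a function $f:2^E\to\mathbb{R}$ with $f(\emptyset)=0$, $f(A)\le f(B)$ whenever $A\subseteq B\subseteq E$, and $f(A\cap B)+f(A\cup B)\le f(A)+f(B)$ for all $A,B\subseteq E$. Define $$Q_g=\{x\in\mathbb{R}^E: x\ge 0,\ x(A)\ge g(A)\ \forall A\subseteq E\},$$ $$Q_{g,c}=\{x\in\mathbb{R}^E: x(e)\le c\ \forall e\in E,\ x(A)\ge g(A)\ \forall A\subseteq E\},\qquad C_{g,c}=\{x\in Q_{g,c}: x(E)=g(E)\}.$$ For a set $K\subseteq\mathbb{R}^E$ and $h>0$, $hK=\{hx:x\in K\}$. *)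

(* Defs.v *)
From HB Require Import structures.
From mathcomp Require Import all_boot all_order all_algebra.
From mathcomp Require Import all_classical all_reals all_analysis.
Set Implicit Arguments.
Unset Strict Implicit.
Unset Printing Implicit Defensive.
Import Order.TTheory GRing.Theory Num.Theory.
Local Open Scope classical_set_scope.
Local Open Scope ring_scope.

(* Subsets of the ground set E are finsets [{set E}]; sets of vectors and of
   reals are classical sets.  Vectors of R^E are functions [E -> R], with the
   pointwise module structure. *)

Section Defs.
Variables (R : realType) (E : finType).
Implicit Types (f g : {set E} -> R) (x s m z : E -> R) (A B U : {set E}).

Definition vsum x A : R := \sum_(e in A) x e.

Definition dot m z : R := \sum_e m e * z e.

(* The default value 0 is harmless: all terms are nonnegative. *)
Definition supnorm s : R := \big[Num.max/0]_e `|s e|.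

Definition polymatroid_fun f : Prop :=
  [/\ f finset.set0 = 0,
      forall A B, A \subset B -> f A <= f B &
      forall A B, f (A :&: B) + f (A :|: B) <= f A + f B].

Definition cofun f U : R := f [set: E]%SET - f ([set: E]%SET :\: U).

Definition Qset g : set (E -> R) :=
  [set x | (forall e, 0 <= x e) /\ (forall A, g A <= vsum x A)].

Definition Qcap g (c : R) : set (E -> R) :=
  [set x | (forall e, x e <= c) /\ (forall A, g A <= vsum x A)].

Definition Cbase g (c : R) : set (E -> R) :=
  [set x | Qcap g c x /\ vsum x [set: E]%SET = g [set: E]%SET].

Definition dilate (h : R) (K : set (E -> R)) : set (E -> R) :=
  [set h *: x | x in K].

Definition Feas g (c : R) s (h : R) : set (E -> R) :=
  [set z | (forall e, 0 <= z e) /\ dilate h (Cbase g c) (s - z)].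

Definition is_maximum (X : set R) (v : R) : Prop := X v /\ ubound X v.

Definition is_minimum (X : set R) (v : R) : Prop := X v /\ lbound X v.

Definition optimal m (Z : set (E -> R)) z : Prop :=
  Z z /\ forall z', Z z' -> dot m z <= dot m z'.

End Defs.

(* Main.v *)
Require Import Defs.
From HB Require Import structures.
From mathcomp Require Import all_boot all_order all_algebra.
From mathcomp Require Import all_classical all_reals all_analysis.
From mathcomp Require Import lra.
Import Order.TTheory GRing.Theory Num.Theory.
Import numFieldNormedType.Exports.
Local Open Scope classical_set_scope.
Local Open Scope ring_scope.

(** Passing to complements turns [C_{g,c}] into the base polytope of [f]: the
vectors [y] with [y(A) <= f(A)] for all [A] and [y(E) = f(E)]; the bounds
[y(e) <= c] hold automatically there because [f(E) <= c].  So, writing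
[y = s - z], the problem over [F_h] is to maximize [m . y] over the bases
[y <= s] of [h f].

Everything rests on comparing these problems with one linear program: maximize
[m . y] over the vectors [0 <= y <= s] with [y(A) <= beta f(A)] for all [A].
For [h <= beta] each base [y <= s] of [h f] is feasible for it, as [f >= 0].
The program has an optimal solution, by compactness
([linear_max_on_capped_box]).  Finally each of its feasible points lies below
some base [x <= s] of [beta f] ([extend_to_base]): a vector that cannot be
increased is saturated outside a tight set [T], so its total is
[beta f(T) + s(E \ T)], and this is at least [beta f(E)] precisely because
[s] lies in [beta Q_g].  As [m >= 0], passing to the larger vector loses
nothing, so an optimal solution can be taken in [F_beta] and is at least as
good as every point of every [F_h], [h <= beta].  When [h > beta] the set
[F_h] is empty, since [s] then is not in [h Q_g]. *)

(** * Modular functions of vectors *)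

Lemma vsumZ {R : realType} {E : finType} (h : R) (x : E -> R) (A : {set E}) :
  vsum (h *: x) A = h * vsum x A.
Proof. by rewrite /vsum mulr_sumr. Qed.

Lemma ler_vsum {R : realType} {E : finType} (x y : E -> R) (A : {set E}) :
  (forall e, x e <= y e) -> vsum x A <= vsum y A.
Proof. by move=> xy; apply: ler_sum. Qed.

Lemma vsum1 {R : realType} {E : finType} (x : E -> R) (e : E) :
  vsum x [set e]%SET = x e.
Proof. exact: big_set1. Qed.

Lemma vsumID {R : realType} {E : finType} (x : E -> R) (A B : {set E}) :
  vsum x (A :&: B)%SET + vsum x (A :\: B)%SET = vsum x A.
Proof. by rewrite [RHS](big_setID B). Qed.

Lemma vsumC {R : realType} {E : finType} (x : E -> R) (A : {set E}) :
  vsum x A + vsum x ([set: E] :\: A)%SET = vsum x [set: E]%SET.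
Proof. by rewrite -[RHS](vsumID x _ A) finset.setTI. Qed.

Lemma vsumUI {R : realType} {E : finType} (x : E -> R) (A B : {set E}) :
  vsum x (A :&: B)%SET + vsum x (A :|: B)%SET = vsum x A + vsum x B.
Proof.
rewrite -(vsumID x (A :|: B)%SET A) finset.setUK finset.setDUl finset.setDv.
by rewrite finset.set0U addrCA finset.setIC vsumID.
Qed.

Definition bump {R : realType} {E : finType} (x : E -> R) (e : E) (d : R) :
    E -> R :=
  fun i => x i + (if i == e then d else 0).

Lemma vsum_bump {R : realType} {E : finType} (x : E -> R) e d (A : {set E}) :
  vsum (bump x e d) A = vsum x A + (if e \in A then d else 0).
Proof.
rewrite /vsum big_split /=; congr (_ + _).
case: ifP => eA; last first.
  by rewrite big1 // => i iA; case: eqP => // ie; rewrite -ie iA in eA.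
rewrite (bigD1 e) //= eqxx big1 ?addr0 // => i /andP[_ /negbTE ->] //.
Qed.

Lemma dotB {R : realType} {E : finType} (m x y : E -> R) :
  dot m (x - y) = dot m x - dot m y.
Proof. by rewrite /dot -sumrB; apply: eq_bigr => e _; rewrite mulrBr. Qed.

Lemma ler_dot {R : realType} {E : finType} (m x y : E -> R) :
  (forall e, 0 <= m e) -> (forall e, x e <= y e) -> dot m x <= dot m y.
Proof. by move=> m0 xy; apply: ler_sum => e _; exact: ler_wpM2l. Qed.

(** * Linear optimization over a box with upper bounds on subset sums *)

Lemma weighted_sum_continuous {R : realType} {E : finType} (P : pred E)
    (w : E -> R) :
  continuous ((fun x => \sum_(e | P e) w e * x e) : {ptws E -> R} -> R).
Proof.
apply: continuous_big => [|e _ x].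
  exact: add_continuous.
apply: (@continuous_comp {ptws E -> R} R R (fun y => y e) ( *%R (w e))).
  exact: (@proj_continuous E (fun=> R)).
exact: mulrl_continuous.
Qed.

(** The coordinate bounds make the set a closed part of a product of segments,
hence compact for the topology of pointwise convergence. *)
Lemma linear_max_on_capped_box {R : realType} {E : finType} (w lo hi : E -> R)
    (b : {set E} -> R) :
  let K := [set x : E -> R | (forall e, lo e <= x e <= hi e) /\
                             (forall A, vsum x A <= b A)] in
  K !=set0 -> exists2 x, K x & forall y, K y -> dot w y <= dot w x.
Proof.
move=> K K0.
have cK : compact (K : set {ptws E -> R}).
  pose box := [set x : {ptws E -> R} | forall e, [set` `[lo e, hi e]] (x e)].
  pose caps := \bigcap_(A in [set: {set E}])
    ((fun x : {ptws E -> R} => vsum x A) @^-1` [set t | t <= b A]).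
  have -> : K = box `&` caps.
    apply/seteqP; split=> x /= [xlh xb]; split.
    - by move=> e /=; rewrite in_itv /=.
    - by move=> A _ /=.
    - by move=> e; have := xlh e; rewrite /= in_itv /=.
    - by move=> A; exact: (xb A I).
  apply: compact_closedI.
    apply: (@tychonoff E (fun=> R) (fun e => [set` `[lo e, hi e]])) => e.
    exact: segment_compact.
  apply: closed_bigI => A _; apply: closed_comp; last exact: closed_le.
  move=> x _.
  have -> : (vsum (E:=E) (R:=R))^~ A = (fun x => \sum_(e in A) 1 * x e).
    by apply/funext => y; apply: eq_bigr => e _; rewrite mul1r.
  exact: (@weighted_sum_continuous R E [in A] (fun=> 1)).
have [|x xK xmax] := @compact_EVT_max {ptws E -> R} R (dot w) K K0 cK.
  apply: continuous_subspaceT; exact: weighted_sum_continuous.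
by exists x; [exact: set_mem|move=> y yK; apply: xmax; exact: mem_set].
Qed.

(** * Bases of a submodular function *)

Definition subm_polyhedron {R : realType} {E : finType} (F : {set E} -> R) :
    set (E -> R) :=
  [set x | forall A, vsum x A <= F A].

Definition base_polytope {R : realType} {E : finType} (F : {set E} -> R) :
    set (E -> R) :=
  [set x | subm_polyhedron F x /\ vsum x [set: E]%SET = F [set: E]%SET].

(** Submodularity of [F] against modularity of [x] forces equality for the
union of two sets on which [x] attains its bound, so there is a largest such
set. *)
Lemma largest_tight_set {R : realType} {E : finType} (F : {set E} -> R)
    (x : E -> R) :
  F finset.set0 = 0 ->
  (forall A B, F (A :&: B)%SET + F (A :|: B)%SET <= F A + F B) ->
  subm_polyhedron F x ->
  exists2 T : {set E}, vsum x T = F T &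
    forall A, vsum x A = F A -> A \subset T.
Proof.
move=> F0 Fsub xF; exists (\bigcup_(A : {set E} | vsum x A == F A) A)%SET.
  apply: (big_ind (fun T : {set E} => vsum x T = F T)).
  - by rewrite F0 /vsum big_set0.
  - move=> A B tA tB; apply/eqP; rewrite eq_le xF /=.
    have := vsumUI x A B; have := Fsub A B; have := xF (A :&: B)%SET; lra.
  - by move=> A /eqP.
by move=> A tA; apply: finset.bigcup_sup; exact/eqP.
Qed.

(** Each coordinate of a vector with the largest total is either saturated or
in a tight set; with [T] the largest tight set its total is
[F T + s(E \ T)]. *)
Lemma extend_to_base {R : realType} {E : finType} (F : {set E} -> R)
    (s y : E -> R) :
  F finset.set0 = 0 ->
  (forall A B, F (A :&: B)%SET + F (A :|: B)%SET <= F A + F B) ->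
  (forall A, F [set: E]%SET <= F A + vsum s ([set: E] :\: A)%SET) ->
  subm_polyhedron F y -> (forall e, y e <= s e) ->
  exists2 x, base_polytope F x & forall e, y e <= x e <= s e.
Proof.
move=> F0 Fsub FE yF ys.
have [|x [yxs xF] xmax] := @linear_max_on_capped_box R E (fun=> 1) y s F.
  by exists y; split => // e; rewrite lexx ys.
have dot1 (u : E -> R) : dot (fun=> 1) u = vsum u [set: E]%SET.
  by rewrite /dot /vsum; apply: eq_big => [e|e _]; rewrite ?inE ?mul1r.
exists x => //; split=> //; apply/eqP; rewrite eq_le xF /=.
have [T tT Tmax] := @largest_tight_set R E F x F0 Fsub xF.
suff sat e : e \notin T -> x e = s e.
  rewrite (le_trans (FE T)) // -(vsumC x T) tT lerD2l.
  by apply: ler_sum => e; rewrite inE => /andP[/sat -> _].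
move=> eT; apply/eqP; rewrite eq_le; have /andP[yxe -> /=] := yxs e.
rewrite leNgt; apply/negP => xse.
(* The largest amount by which coordinate [e] can be raised. *)
pose d := \big[Num.min/(s e - x e)]_(A : {set E} | e \in A) (F A - vsum x A).
have d0 : 0 < d.
  apply: lt_bigmin => [|A eA]; first by rewrite subr_gt0.
  rewrite subr_gt0 lt_neqAle xF andbT.
  by apply: contra eT => /eqP/Tmax/fintype.subsetP; exact.
suff : dot (fun=> 1) (bump x e d) <= dot (fun=> 1) x.
  by rewrite !dot1 vsum_bump inE; lra.
apply: xmax; split=> [i|A]; last first.
  rewrite vsum_bump; case: ifP => eA; last by rewrite addr0.
  by rewrite -lerBrDl; apply: bigmin_le_cond.
have /andP[yxi xsi] := yxs i.
rewrite /bump; case: eqP => [->|_]; last by rewrite addr0 yxi.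
rewrite (le_trans yxe) ?lerDl ?(ltW d0)//= -lerBrDl.
exact: bigmin_le_id.
Qed.

(** * The polytope of the sparsification problem *)

Lemma polymatroid_ge0 {R : realType} {E : finType} (f : {set E} -> R) A :
  polymatroid_fun f -> 0 <= f A.
Proof. by case=> f0 fmon _; rewrite -f0; apply/fmon/finset.sub0set. Qed.

(** Complementation turns the lower bounds [g] into the upper bounds [f], and
these imply the cap: [x(e) <= f({e}) <= f(E) <= c]. *)
Lemma Cbase_cofun {R : realType} {E : finType} (f : {set E} -> R) (c : R) :
  polymatroid_fun f -> f [set: E]%SET <= c ->
  Cbase (cofun f) c = base_polytope f.
Proof.
move=> [f0 fmon fsub] fc.
have gE : cofun f [set: E]%SET = f [set: E]%SET.
  by rewrite /cofun finset.setDv f0 subr0.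
apply/seteqP; split=> x.
  move=> [[xc xg] xE]; rewrite gE in xE; split=> // A.
  have := xg ([set: E] :\: A)%SET; rewrite /cofun.
  rewrite finset.setDDr finset.setDv finset.set0U finset.setTI.
  have := vsumC x A; lra.
move=> [xf xE]; split; last by rewrite gE.
split=> [e|A].
  by rewrite -vsum1 (le_trans (xf _)) // (le_trans _ fc) // fmon ?finset.subsetT.
rewrite /cofun; have := vsumC x A; have := xf ([set: E] :\: A)%SET; lra.
Qed.

Lemma dilate_base_polytope {R : realType} {E : finType} (f : {set E} -> R)
    (h : R) : 0 < h ->
  dilate h (base_polytope f) = base_polytope (fun A => h * f A).
Proof.
move=> h0; apply/seteqP; split=> y.
  by move=> [x [xf xE] <-]; split=> [A|]; rewrite vsumZ ?xE // ler_pM2l.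
move=> [yf yE]; exists (h^-1 *: y); last first.
  by rewrite scalerA divff ?gt_eqF // scale1r.
split=> [A|]; rewrite vsumZ; first by rewrite ler_pdivrMl.
by rewrite yE mulKf ?gt_eqF.
Qed.

(** As [Q_g] is closed under increasing vectors, a feasible point of [F_h] puts
[s] itself in [h Q_g]; this bounds [h] by [beta]. *)
Lemma dilate_Qset_above {R : realType} {E : finType} (g : {set E} -> R)
    (s y : E -> R) (c h : R) :
  0 < h -> (forall e, 0 <= s e) -> (forall e, y e <= s e) ->
  dilate h (Cbase g c) y -> dilate h (Qset g) s.
Proof.
move=> h0 s0 ys [x [[_ xg] _] xy].
exists (h^-1 *: s); last by rewrite scalerA divff ?gt_eqF // scale1r.
split=> [e|A]; first by rewrite mulr_ge0 // invr_ge0 ltW.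
rewrite (le_trans (xg A)) // vsumZ ler_pdivlMl // -vsumZ.
by rewrite xy; exact: ler_vsum.
Qed.

(** One linear program, over [0 <= p <= s] and [p(A) <= beta f(A)], relaxes the
problems for all dilation factors [h <= beta]; raising its optimal solution to
a base of [beta f] shows that the relaxation is exact at [h = beta]. *)
Lemma best_base {R : realType} {E : finType} (f : {set E} -> R) (s m : E -> R)
    (beta : R) :
  polymatroid_fun f -> (forall e, 0 <= m e) ->
  0 < beta -> dilate beta (Qset (cofun f)) s ->
  exists2 x, base_polytope (fun A => beta * f A) x /\ (forall e, x e <= s e) &
    forall h y, 0 < h <= beta -> base_polytope (fun A => h * f A) y ->
      (forall e, y e <= s e) -> dot m y <= dot m x.
Proof.
move=> pf m0 b0 [q [q0 qg] qs]; have [f0 fmon fsub] := pf.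
have s0 e : 0 <= s e by rewrite -qs; apply: mulr_ge0; rewrite ?q0 ?ltW.
have f_ge0 A : 0 <= f A by exact: polymatroid_ge0.
have bsub A B : beta * f (A :&: B)%SET + beta * f (A :|: B)%SET
    <= beta * f A + beta * f B by rewrite -!mulrDr ler_pM2l.
have bE A : beta * f [set: E]%SET
    <= beta * f A + vsum s ([set: E] :\: A)%SET.
  rewrite -qs vsumZ -mulrDr ler_pM2l //.
  have := qg ([set: E] :\: A)%SET; rewrite /cofun.
  rewrite finset.setDDr finset.setDv finset.set0U finset.setTI; lra.
have [|p [p0s pf'] pmax] := @linear_max_on_capped_box R E m (fun=> 0) s
  (fun A => beta * f A).
  exists (fun=> 0); split=> [e|A]; first by rewrite lexx s0.
  by rewrite /vsum big1 // mulr_ge0 // ltW.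
have [||x xB pxs] := @extend_to_base R E (fun A => beta * f A) s p _ bsub bE pf'.
- by rewrite f0 mulr0.
- by move=> e; have /andP[] := p0s e.
exists x; first by split=> // e; have /andP[] := pxs e.
move=> h y /andP[h0 hb] [yf yE] ys.
have px : dot m p <= dot m x.
  by apply: ler_dot => // e; have /andP[] := pxs e.
apply: le_trans px; apply: pmax; split=> [e|A]; last first.
  by rewrite (le_trans (yf A)) // ler_wpM2r.
(* A base is nonnegative: by monotonicity omitting [e] cannot raise [f]. *)
rewrite ys andbT -vsum1.
have := vsumC y [set e]%SET; rewrite yE.
have := yf ([set: E] :\: [set e])%SET.
have : h * f ([set: E] :\: [set e])%SET <= h * f [set: E]%SET.
  by rewrite ler_pM2l // fmon ?finset.subsetT.
lra.
Qed.

Theorem theorem3p16 (R : realType) (E : finType) (f : {set E} -> R)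
    (s m : E -> R) (c beta : R) :
  polymatroid_fun f ->
  (forall e, 0 < s e) ->
  (forall e, 0 <= m e) ->
  Num.max (f [set: E]%SET) (supnorm s) <= c ->
  is_maximum [set h : R | 0 < h /\ dilate h (Qset (cofun f)) s] beta ->
  (forall (h : R) (zh zbeta : E -> R), 0 < h <= beta ->
     optimal m (Feas (cofun f) c s h) zh ->
     optimal m (Feas (cofun f) c s beta) zbeta ->
     dot m zbeta <= dot m zh) /\
  (exists v : R,
     is_minimum [set dot m z | z in Feas (cofun f) c s beta] v /\
     is_minimum [set dot m z | z in
       [set z : E -> R | (forall e, 0 <= z e) /\
          exists h : R, 0 < h /\ dilate h (Cbase (cofun f) c) (s - z)]] v).
Proof.
move=> pf s0 m0; rewrite ge_max => /andP[fc _] [[b0 sQ] bmax].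
have hC h : 0 < h ->
    dilate h (Cbase (cofun f) c) = base_polytope (fun A => h * f A).
  by move=> h0; rewrite Cbase_cofun // dilate_base_polytope.
have [x [xB xs] xbest] := @best_base R E f s m beta pf m0 b0 sQ.
have zF : Feas (cofun f) c s beta (s - x).
  by split=> [e|]; [rewrite subr_ge0|rewrite subKr hC].
have zle h z : 0 < h -> (forall e, 0 <= z e) ->
    dilate h (Cbase (cofun f) c) (s - z) -> dot m (s - x) <= dot m z.
  move=> h0 z0 zh.
  have szs e : (s - z) e <= s e by rewrite gerBl.
  have hb : h <= beta.
    apply: bmax; split=> //.
    apply: (dilate_Qset_above _ s (s - z) c) => // e; exact: ltW.
  rewrite dotB lerBlDl -lerBlDr -dotB; apply: (xbest h) => //.
    by rewrite h0.
  by rewrite -hC.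
split=> [h zh zb /andP[h0 hb] [[zh0 zhC] _] [_ zbmin]|].
  by rewrite (le_trans (zbmin _ zF)) // (zle h).
exists (dot m (s - x)); split; split.
- by exists (s - x).
- by move=> _ [z [z0 zC] <-]; exact: (zle beta).
- by exists (s - x) => //; case: zF => z0 zC; split=> //; exists beta.
- by move=> _ [z [z0 [h [h0 zC]]] <-]; exact: (zle h).
Qed.
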